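(* A finite bipartite multigraph (with distinguished sets of left and right vertices) is isomorphic, as a bipartite multigraph preserving the left/right sides, to the configuration graph of some primitive, aperiodic substitution if and only if it is undecided.
   Context: Let $\mathcal{A}$ be a finite nonempty alphabet and $\tau:\mathcal{A}\to\mathcal{A}^+$ a substitution (nonempty word assigned to each letter), extended to a concatenation-respecting map on words. For $x\in\mathcal{A}^{\mathbb{Z}}$, $x_{[i]}$ denotes the letter at index $i$ and $x_{[i,j]}$ the word $x_{[i]}\cdots x_{[j]}$. The language $\mathcal{L}(\tau)$ is the set of words that are factors of $\tau^m(a)$ for some letter $a$ and some $m\ge1$; $X_\tau=\{x\in\mathcal{A}^{\mathbb{Z}}: x_{[i,j]}\in\mathcal{L}(\tau)\ \forall i\le j\}$. $\tau$ is primitive if there is $m\ge1$ such that every letter $b$ is a factor of $\tau^m(a)$ for every letter $a$, and there is a letter $a$ such that for every $N$ there is $m$ with $|\tau^m(a)|>N$; a primitive $\tau$ is aperiodic if $X_\tau$ is infinite. For $x,y\in X_\tau$: $x\sim_o y$ iff there is $m\in\mathbb{Z}$ with $x_{[i]}=y_{[i+m]}$ for all $i$; $x\sim_r y$ iff there are $m,M\in\mathbb{Z}$ with $x_{[i]}=y_{[i+m]}$ for all $i\ge M$; $x\sim_l y$ iff there are $m,M\in\mathbb{Z}$ with $x_{[i]}=y_{[i+m]}$ for all $i\le M$. These are equivalence relations; the $\sim_o$-classes are called orbit classes, and $\sim_r$, $\sim_l$ induce equivalence relations on orbit classes. An orbit class $C$ is left special if there is an orbit class $D\neq C$ with $C\sim_r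 D$, right special if there is an orbit class $D\ne C$ with $C\sim_l D$, and special if it is left or right special. For primitive aperiodic $\tau$ the number of special orbit classes is known to be finite and nonzero. The configuration graph of a primitive aperiodic $\tau$ is the bipartite multigraph whose left vertices are the $\sim_l$-equivalence classes of orbit classes that contain a special orbit class, whose right vertices are the $\sim_r$-equivalence classes of orbit classes that contain a special orbit class, and which has one edge for each special orbit class $C$, joining the $\sim_l$-class of $C$ to the $\sim_r$-class of $C$ (parallel edges allowed). A bipartite multigraph is undecided if: (i) every vertex is incident to at least one edge; (ii) every edge shares at least one vertex with some other edge (a parallel edge counts); (iii) some left vertex is incident to at least two edges; (iv) some right vertex is incident to at least two edges. *)

(* Defs.v *)
From mathcomp Require Import all_boot all_order all_algebra.
Set Implicit Arguments. Unset Strict Implicit. Unset Printing Implicit Defensive.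
Import Order.TTheory GRing.Theory Num.Theory.
Local Open Scope ring_scope.

Section Subst.
Variable A : finType.

(* A substitution is a map A -> seq A; nonemptiness of images is a separate hypothesis. *)
Definition subst_word (tau : A -> seq A) (w : seq A) : seq A :=
  flatten (map tau w).

Definition iter_subst (tau : A -> seq A) (m : nat) (a : A) : seq A :=
  iter m (subst_word tau) [:: a].

Definition nonerasing (tau : A -> seq A) : Prop := forall a, tau a != [::].

Definition in_language (tau : A -> seq A) (w : seq A) : Prop :=
  exists (m : nat) (a : A), (1 <= m)%N /\ infix w (iter_subst tau m a).

Definition window (x : int -> A) (i : int) (n : nat) : seq A :=
  mkseq (fun k => x (i + k%:Z)) n.+1.

Definition in_subshift (tau : A -> seq A) (x : int -> A) : Prop :=
  forall (i : int) (n : nat), in_language tau (window x i n).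

Definition primitive (tau : A -> seq A) : Prop :=
  (exists m : nat, (1 <= m)%N /\ forall a b : A, b \in iter_subst tau m a) /\
  (exists a : A, forall N : nat, exists m : nat, (N < size (iter_subst tau m a))%N).

Definition finite_pointset (P : (int -> A) -> Prop) : Prop :=
  exists (n : nat) (f : 'I_n -> int -> A), forall x, P x -> exists k, x = f k.

Definition aperiodic (tau : A -> seq A) : Prop :=
  ~ finite_pointset (in_subshift tau).

Definition orbit_eq (x y : int -> A) : Prop :=
  exists m : int, forall i : int, x i = y (i + m).

Definition right_eq (x y : int -> A) : Prop :=
  exists m M : int, forall i : int, M <= i -> x i = y (i + m).

Definition left_eq (x y : int -> A) : Prop :=
  exists m M : int, forall i : int, i <= M -> x i = y (i + m).

Definition left_special (tau : A -> seq A) (x : int -> A) : Prop :=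
  exists y, in_subshift tau y /\ right_eq x y /\ ~ orbit_eq x y.

Definition right_special (tau : A -> seq A) (x : int -> A) : Prop :=
  exists y, in_subshift tau y /\ left_eq x y /\ ~ orbit_eq x y.

Definition special (tau : A -> seq A) (x : int -> A) : Prop :=
  in_subshift tau x /\ (left_special tau x \/ right_special tau x).

End Subst.

(* The configuration graph of tau, described through representatives:
   - edges = special orbit classes (points of X_tau modulo ~o that are special),
   - left vertices = ~l-classes containing a special orbit class,
   - right vertices = ~r-classes containing a special orbit class,
   edge [x]_o joins [x]_l to [x]_r.
   [config_iso tau src tgt] states that the finite bipartite multigraph
   (L, R, E, src, tgt) is isomorphic (preserving sides) to it: fE, fL, fR pick
   representatives inducing bijections on the classes, compatible with incidence. *)
Definition config_iso (A : finType) (tau : A -> seq A)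
    (L R E : finType) (src : E -> L) (tgt : E -> R) : Prop :=
  exists (fE : E -> int -> A) (fL : L -> int -> A) (fR : R -> int -> A),
    (forall e, special tau (fE e)) /\
    (forall e e', orbit_eq (fE e) (fE e') -> e = e') /\
    (forall x, special tau x -> exists e, orbit_eq (fE e) x) /\
    (forall v, in_subshift tau (fL v) /\
               exists x, special tau x /\ left_eq (fL v) x) /\
    (forall v v', left_eq (fL v) (fL v') -> v = v') /\
    (forall x, special tau x -> exists v, left_eq (fL v) x) /\
    (forall w, in_subshift tau (fR w) /\
               exists x, special tau x /\ right_eq (fR w) x) /\
    (forall w w', right_eq (fR w) (fR w') -> w = w') /\
    (forall x, special tau x -> exists w, right_eq (fR w) x) /\
    (forall e, left_eq (fE e) (fL (src e)) /\ right_eq (fE e) (fR (tgt e))).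

Definition undecided (L R E : finType) (src : E -> L) (tgt : E -> R) : Prop :=
  ((forall v : L, exists e : E, src e = v) /\ (forall w : R, exists e : E, tgt e = w)) /\
  (forall e : E, exists e' : E, e' <> e /\ (src e' = src e \/ tgt e' = tgt e)) /\
  (exists e1 e2 : E, e1 <> e2 /\ src e1 = src e2) /\
  (exists e1 e2 : E, e1 <> e2 /\ tgt e1 = tgt e2).

(* Main.v *)
(** If [X_tau] is infinite, compactness produces two points that agree to the right of
    [0] and differ at [0]; were they in one orbit, they would be eventually periodic and
    recurrence would make [X_tau] finite. The same on the left gives conditions (iii) and
    (iv); conditions (i) and (ii) are formal.

    Conversely, take the edges as letters and put
      [tau e = P_(src e) . e . S_(tgt e)],
    a constant length substitution where [P_v] begins with a code word for [v] over two
    letters with equal source, and [S_w] ends with a code word for [w] over two letters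
    with equal target. Each letter [e] sits in the middle of its own image, so it spans
    a bi-infinite fixed point [x_e], whose left (right) half depends on [src e] ([tgt e])
    only. A marker inside [S_w] makes [tau] recognizable. Desubstituting a pair of
    points that agree on one side of [0] and differ at [0] yields another such pair; after
    one step the two letters at [0] have equal target (source), hence every step is
    centered and the points are [x_a] and [x_b]. *)

Require Import Defs.
From mathcomp Require Import all_boot all_order all_algebra zify.
From Stdlib Require Import FunctionalExtensionality ClassicalEpsilon.
Set Implicit Arguments. Unset Strict Implicit. Unset Printing Implicit Defensive.
Import Order.TTheory GRing.Theory Num.Theory.
Local Open Scope ring_scope.

(** * Factors of words and iterates of a substitution *)

Lemma infix_windowP (A : finType) (a0 : A) (x : int -> A) (i : int) (n : nat) (w : seq A) :
  infix (window x i n) w <->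
  exists s : nat, (s + n < size w)%N /\
    forall t : nat, (t <= n)%N -> x (i + t%:Z) = nth a0 w (s + t).
Proof.
split.
  case/infixP=> u [v ->]; exists (size u); rewrite !size_cat size_mkseq; split.
    by rewrite -addnS leq_add2l leq_addr.
  move=> t tn; rewrite nth_cat ifF; last by rewrite ltnNge leq_addr.
  by rewrite addKn nth_cat size_mkseq ltnS tn nth_mkseq.
case=> s [sw H]; apply/infixP; exists (take s w), (drop n.+1 (drop s w)).
have -> : window x i n = take n.+1 (drop s w).
  have sz : size (take n.+1 (drop s w)) = n.+1.
    by rewrite size_takel // size_drop; lia.
  apply: (@eq_from_nth _ a0); first by rewrite sz size_mkseq.
  move=> t; rewrite size_mkseq => tn.
  by rewrite nth_mkseq // nth_take // nth_drop H.
by rewrite !cat_take_drop.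
Qed.

Lemma subst_word_cat (A : finType) (tau : A -> seq A) (u v : seq A) :
  subst_word tau (u ++ v) = subst_word tau u ++ subst_word tau v.
Proof. by rewrite /subst_word map_cat flatten_cat. Qed.

Lemma iter_subst_word_cat (A : finType) (tau : A -> seq A) (m : nat) (u v : seq A) :
  iter m (subst_word tau) (u ++ v) =
  iter m (subst_word tau) u ++ iter m (subst_word tau) v.
Proof. by elim: m => //= m ->; rewrite subst_word_cat. Qed.

Lemma infix_iter_subst_word (A : finType) (tau : A -> seq A) (m : nat) (u v : seq A) :
  infix u v -> infix (iter m (subst_word tau) u) (iter m (subst_word tau) v).
Proof.
case/infixP=> s [t ->]; apply/infixP.
by exists (iter m (subst_word tau) s), (iter m (subst_word tau) t);
   rewrite !iter_subst_word_cat.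
Qed.

Lemma iter_subst_wordE (A : finType) (tau : A -> seq A) (m : nat) (s : seq A) :
  iter m (subst_word tau) s = flatten (map (iter_subst tau m) s).
Proof.
elim: s => [|a s IH]; first by elim: m => //= m ->.
by rewrite -cat1s iter_subst_word_cat IH.
Qed.

(** * Asymptotic pairs in infinite subshifts *)

Lemma uniform_bound (Q : nat -> nat -> Prop) (n : nat) :
  (forall i K K' : nat, (K <= K')%N -> Q i K -> Q i K') ->
  (forall i, (i < n)%N -> exists K, Q i K) ->
  exists K, forall i, (i < n)%N -> Q i K.
Proof.
move=> mono; elim: n => [|n IH] H; first by exists 0%N.
have [|K HK] := IH; first by move=> i Hi; apply: H; lia.
have [K' HK'] := H n (ltnSn n).
exists (maxn K K') => i; rewrite ltnS leq_eqVlt => /orP [/eqP -> | Hi].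
  by apply: mono HK'; lia.
by apply: mono (HK i Hi); lia.
Qed.

Lemma finite_uniform_bound (T : finType) (Q : T -> nat -> Prop) :
  (forall t (K K' : nat), (K <= K')%N -> Q t K -> Q t K') ->
  (forall t, exists K, Q t K) -> exists K, forall t, Q t K.
Proof.
move=> mono H.
have [||K HK] := @uniform_bound (fun i K => forall t : T, enum_rank t = i :> nat -> Q t K) #|T|.
- by move=> i K K' le HK t Ht; apply: mono le (HK t Ht).
- move=> i Hi; have [K HK] := H (enum_val (Ordinal Hi)); exists K => t Ht.
  suff -> : t = enum_val (Ordinal Hi) by [].
  by rewrite -[t]enum_rankK; congr enum_val; apply: val_inj.
by exists K => t; apply: (HK (enum_rank t)).
Qed.

(** * Compactness of the space of bi-infinite sequences *)

Section Compactness.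
Variables (B : finType) (b0 : B) (u : nat -> int -> B).

(** The word [s] prescribes a letter at each integer whose [pickle] code is below [size s], and
    infinitely many [u N] have to comply. *)
Let frequent (s : seq B) : Prop :=
  forall N0, exists2 N, (N0 <= N)%N &
    forall i : int, (pickle i < size s)%N -> u N i = nth b0 s (pickle i).

(** Pigeonhole over the letters: if each extension of [s] were met by finitely many [u N] only, a
    common bound on these indices would contradict [frequent s]. *)
Let frequent_rcons s : frequent s -> exists b, frequent (rcons s b).
Proof.
move=> fs; apply: NNPP => H.
have [||K HK] := @finite_uniform_bound B (fun b K => forall N, (K <= N)%N ->
    ~ forall i : int, (pickle i < (size s).+1)%N -> u N i = nth b0 (rcons s b) (pickle i)).
- by move=> b K K' le HK N leN; apply: HK; lia.
- move=> b; apply: NNPP => H2; apply: H; exists b => N0.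
  apply: NNPP => H3; apply: H2; exists N0 => N leN H4; apply: H3; exists N => //.
  by move=> i; rewrite size_rcons; apply: H4.
have [N leN HN] := fs K.
have [[i Hi]|no] := classic (exists i : int, pickle i = size s).
  apply: (HK (u N i) N leN) => i'; rewrite ltnS leq_eqVlt nth_rcons => /orP [/eqP e|lt].
    rewrite e ltnn eqxx; congr u.
    by apply: (@pcan_inj _ _ _ _ (@pickleK int)); rewrite e Hi.
  by rewrite lt; apply: HN.
(* No integer has code [size s] here, so the appended letter constrains nothing and [b0] serves. *)
apply: (HK b0 N leN) => i'; rewrite ltnS leq_eqVlt nth_rcons => /orP [/eqP e|lt].
  by case: no; exists i'.
by rewrite lt; apply: HN.
Qed.

Lemma int_sequence_compact : exists z : int -> B, forall K N0 : nat,
  exists2 N, (N0 <= N)%N & forall i : int, (`|i| <= K)%N -> u N i = z i.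
Proof.
(* The limit [z] is read off a chain of frequent words, each extending the previous one. *)
pose next s := epsilon (inhabits b0) (fun b => frequent (rcons s b)).
pose pre n := iter n (fun s => rcons s (next s)) [::].
have sz n : size (pre n) = n by elim: n => //= n IH; rewrite size_rcons IH.
have fq n : frequent (pre n).
  elim: n => [|n IH]; first by move=> N0; exists N0.
  exact: (epsilon_spec (inhabits b0) _ (frequent_rcons IH)).
have st n m d : (m < n)%N -> nth b0 (pre (n + d)%N) m = nth b0 (pre n) m.
  move=> lt; elim: d => [|d IH]; first by rewrite addn0.
  by rewrite addnS /= nth_rcons -/(pre _) sz (ltn_addr _ lt).
exists (fun i => nth b0 (pre (pickle i).+1) (pickle i)) => K N0.
have [||M HM] := @uniform_bound (fun i M => (pickle (i%:Z) < M)%N /\ (pickle (- i%:Z) < M)%N) K.+1.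
- by move=> i M M' le [h1 h2]; split; apply: leq_trans le.
- move=> i _; exists (maxn (pickle (i%:Z)) (pickle (- i%:Z))).+1.
  by rewrite !ltnS leq_maxl leq_maxr.
have [N leN HN] := fq M N0; exists N => // i iK.
have lt : (pickle i < M)%N.
  have [h1 h2] := HM `|i|%N iK.
  have [e|e] : i = `|i|%N%:Z \/ i = - `|i|%N%:Z by lia.
    by rewrite e.
  by rewrite e.
by rewrite HN ?sz // -(subnKC lt) st.
Qed.

End Compactness.

Definition closed_pointset (A : finType) (P : (int -> A) -> Prop) : Prop :=
  forall z, (forall K : nat, exists x, P x /\
    forall i : int, (`|i| <= K)%N -> x i = z i) -> P z.

(** The one-sided form of minimality that the periodicity argument uses. *)
Definition right_recurrent (A : finType) (P : (int -> A) -> Prop) : Prop :=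
  forall z x (l i : int) (n : nat), P z -> P x ->
  exists2 j : int, i <= j & forall t : nat, (t <= n)%N -> z (l + t%:Z) = x (j + t%:Z).

Section Subshift.
Variables (A : finType) (P : (int -> A) -> Prop).
Hypothesis Pshift : forall x (m : int), P x -> P (fun i => x (i + m)).
Hypothesis Pclosed : closed_pointset P.

(** Otherwise a right half determines the letter at [0], and by compactness its first [N] letters
    already do. Any [N] consecutive letters then determine everything to their left. But an infinite
    set has more than [#|A|^N] points that differ pairwise near [0], and two of them share a window
    of length [N] further right. *)
Lemma asymptotic_pair : ~ finite_pointset P ->
  exists x y, [/\ P x, P y, forall i : int, 0 < i -> x i = y i & x 0 <> y 0].
Proof.
move=> Pinf; apply: NNPP => no.
have det x y : P x -> P y -> (forall i : int, 0 < i -> x i = y i) -> x 0 = y 0.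
  by move=> Px Py H; apply: NNPP => ne; apply: no; exists x, y.
have [x0 Px0] : exists x, P x.
  apply: NNPP => H; apply: Pinf; exists 0%N, (fun i : 'I_0 => False_rect _ (notF (ltn_ord i))).
  by move=> x Px; case: H; exists x.
have [N HN] : exists N : nat, forall x y, P x -> P y ->
    (forall i : int, 0 < i -> i <= N%:Z -> x i = y i) -> x 0 = y 0.
  apply: NNPP => H.
  have H' (N : nat) : exists xy : (int -> A) * (int -> A), [/\ P xy.1, P xy.2,
      forall i : int, 0 < i -> i <= N%:Z -> xy.1 i = xy.2 i & xy.1 0 <> xy.2 0].
    apply: NNPP => H2; apply: H; exists N => x y Px Py Hi; apply: NNPP => ne.
    by apply: H2; exists (x, y).
  pose pr N := proj1_sig (constructive_indefinite_description _ (H' N)).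
  have prP N : [/\ P (pr N).1, P (pr N).2,
      forall i : int, 0 < i -> i <= N%:Z -> (pr N).1 i = (pr N).2 i & (pr N).1 0 <> (pr N).2 0].
    exact: (proj2_sig (constructive_indefinite_description _ (H' N))).
  (* Compactness is applied to pairs, as sequences over the product alphabet, so that both limits
     come from the same indices. *)
  have [z Hz] := @int_sequence_compact _ (x0 0, x0 0) (fun N i => ((pr N).1 i, (pr N).2 i)).
  have z0 : (z 0).1 <> (z 0).2.
    have [M _ HM] := Hz 0%N 0%N; have [_ _ _ ne] := prP M.
    by rewrite -(HM 0).
  apply: z0; apply: (det (fun i => (z i).1) (fun i => (z i).2)).
  - apply: Pclosed => K; have [M _ HM] := Hz K 0%N; have [P1 _ _ _] := prP M.
    by exists (pr M).1; split=> // i iK; rewrite -HM.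
  - apply: Pclosed => K; have [M _ HM] := Hz K 0%N; have [_ P2 _ _] := prP M.
    by exists (pr M).2; split=> // i iK; rewrite -HM.
  - move=> i i0; have [M leM HM] := Hz `|i|%N `|i|%N; have [_ _ e _] := prP M.
    by rewrite -HM //=; apply: e; lia.
have [f [K [Pf Hf]]] : exists (f : nat -> int -> A) (K : nat),
    (forall i, (i < #|{ffun 'I_N -> A}|.+1)%N -> P (f i)) /\
    forall i j, (i < j < #|{ffun 'I_N -> A}|.+1)%N ->
      exists t : int, (`|t| <= K)%N /\ f i t <> f j t.
  elim: (#|_|.+1) => [|n [f [K [Pf Hf]]]].
    by exists (fun _ => x0), 0%N; split=> // i j; lia.
  have [x [Px Hx]] : exists x, P x /\ forall k : 'I_n, x <> f k.
    apply: NNPP => H; apply: Pinf; exists n, (fun k => f k) => x Px.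
    apply: NNPP => H2; apply: H; exists x; split=> // k e; apply: H2; by exists k.
  have [||K' HK'] := @uniform_bound (fun i K' => exists t : int, (`|t| <= K')%N /\ f i t <> x t) n.
  - by move=> i M M' le [t [t1 t2]]; exists t; split=> //; lia.
  - move=> i Hi; apply: NNPP => H; apply: (Hx (Ordinal Hi)).
    apply: functional_extensionality => t; apply: NNPP => ne; apply: H.
    by exists `|t|%N, t; split=> // e; apply: ne.
  exists (fun i => if i == n then x else f i), (maxn K K'); split.
    move=> i Hi; case: eqP => // ne; apply: Pf; lia.
  move=> i j /andP [ij jn]; have -> : (i == n) = false by lia.
  case: eqP => [e|ne].
    have [|t [t1 t2]] := HK' i; first by lia.
    by exists t; split=> //; lia.
  have [|t [t1 t2]] := Hf i j; first by lia.
  by exists t; split=> //; lia.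
(* The window of length [N] just right of the radius [K] within which the chosen points differ;
   there are fewer windows than points. *)
pose g (i : 'I_#|{ffun 'I_N -> A}|.+1) : {ffun 'I_N -> A} :=
  [ffun t : 'I_N => f i (K%:Z + 1 + t%:Z)].
have ninj : ~ injective g by move/leq_card; rewrite card_ord ltnn.
apply: ninj.
have prop x y : P x -> P y ->
    (forall t : 'I_N, x (K%:Z + 1 + t%:Z) = y (K%:Z + 1 + t%:Z)) ->
    forall s : nat, forall i : int, K%:Z + 1 - s%:Z <= i -> i <= K%:Z + N%:Z -> x i = y i.
  move=> Px Py H; elim=> [|s IH] i h1 h2.
    have lt : (absz (i - (K%:Z + 1))%R < N)%N by lia.
    have := H (Ordinal lt) => /=.
    by have -> : K%:Z + 1 + (absz (i - (K%:Z + 1))%R)%:Z = i by lia.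
  have [h|h] : K%:Z + 1 - s%:Z <= i \/ i = K%:Z - s%:Z by lia.
    exact: IH.
  rewrite -[i]add0r.
  apply: (HN (fun l => x (l + i)) (fun l => y (l + i))) => [||l l1 l2]; try exact: Pshift.
  by apply: IH; lia.
have H (i j : 'I_#|{ffun 'I_N -> A}|.+1) : (i < j)%N -> g i <> g j.
  move=> ij e.
  have [|t [t1]] := Hf i j; first by rewrite ij ltn_ord.
  apply.
  apply: (@prop _ _ _ _ _ (absz (K%:Z + 1 - t)%R)); [exact: Pf|exact: Pf| |lia|lia].
  by move=> l; move/ffunP/(_ l): e; rewrite !ffunE.
move=> i j e; apply: val_inj; have [/H|/H|//] := ltngtP i j => //.
by move=> /(_ (esym e)).
Qed.

(** By recurrence every window of every point occurs in the periodic tail of [x], so every point is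
    one of the [p] shifts of the periodic extension [xh]. *)
Lemma eventually_periodic_finite (x : int -> A) (M : int) (p : nat) :
  right_recurrent P -> P x -> (0 < p)%N ->
  (forall i : int, M <= i -> x i = x (i + p%:Z)) -> finite_pointset P.
Proof.
move=> rec Px p0 per.
pose xh (i : int) := x (M + (`|((i - M) %% p%:Z)%Z|)%N%:Z).
have per2 (n : nat) (i : int) : M <= i -> x (i + (n * p)%N%:Z) = x i.
  elim: n => [|n IH] h; first by rewrite mul0n addr0.
  have np0 : 0 <= (n * p)%N%:Z by [].
  rewrite -IH // [in RHS]per; last by lia.
  by congr x; lia.
have xhE i : M <= i -> x i = xh i.
  move=> h; rewrite /xh -[RHS](per2 `|((i - M) %/ p%:Z)%Z|%N); last by lia.
  congr x.
  have e := divz_eq (i - M) p%:Z.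
  have h1 : 0 <= ((i - M) %/ p%:Z)%Z by rewrite divz_ge0 //; lia.
  have h2 : 0 <= ((i - M) %% p%:Z)%Z by apply: modz_ge0; lia.
  by rewrite PoszM !gez0_abs // -addrA [X in M + X]addrC -e; lia.
have xhp i j : ((i %% p%:Z) = (j %% p%:Z))%Z -> xh i = xh j.
  move=> e; rewrite /xh; congr (x (_ + (`| _ |)%N%:Z)).
  by apply/eqP; rewrite eqz_modDr; apply/eqP.
exists p, (fun (r : 'I_p) i => xh (r%:Z + i)) => z Pz.
apply: NNPP => no.
have [||K HK] := @finite_uniform_bound 'I_p (fun r K => exists t : int, (`|t| <= K)%N /\ z t <> xh (r%:Z + t)).
- by move=> r K K' le [t [t1 t2]]; exists t; split=> //; lia.
- move=> r; apply: NNPP => H; apply: no; exists r.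
  apply: functional_extensionality => t; apply: NNPP => ne; apply: H.
  by exists `|t|%N, t.
(* The window of [z] of radius [K] is found in the tail, centered at [j + K]; the residue of [j + K]
   modulo [p] names a shift that agrees with [z] there. *)
have [j jM Hj] := rec z x (- K%:Z) M (K + K)%N Pz Px.
have lt : (absz ((j + K%:Z) %% p%:Z)%Z < p)%N.
  have := ltz_pmod (j + K%:Z) (d := p%:Z); have := modz_ge0 (j + K%:Z) (d := p%:Z); lia.
have [t [t1 t2]] := HK (Ordinal lt); apply: t2.
have := Hj (absz (t + K%:Z)%R); rewrite gez0_abs; last by lia.
have -> : - K%:Z + (t + K%:Z) = t by lia.
move=> ->; last by lia.
rewrite xhE; last by lia.
apply: xhp => /=; rewrite gez0_abs; last by apply: modz_ge0; lia.
by rewrite modzDml; congr (_ %% _)%Z; lia.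
Qed.

(** If a shift by [m] mapped one point of the asymptotic pair to the other, then [m] would be
    nonzero and the common right half would have period [|m|]. *)
Lemma right_asymptotic_orbits : right_recurrent P -> ~ finite_pointset P ->
  exists x y, [/\ P x, P y, right_eq x y & ~ orbit_eq x y].
Proof.
move=> rec Pinf; have [x [y [Px Py e ne]]] := asymptotic_pair Pinf.
exists x, y; split=> //.
  by exists 0, 1 => i hi; rewrite addr0; apply: e; lia.
case=> m Hm; apply: Pinf.
have [m0|[m0|m0]] : m = 0 \/ 0 < m \/ m < 0 by lia.
- by case: ne; rewrite Hm m0.
- apply: (@eventually_periodic_finite x 1 `|m|%N) => //; first by lia.
  move=> i hi; rewrite Hm -e; last by lia.
  by congr x; lia.
- apply: (@eventually_periodic_finite x (1 - m) `|m|%N) => //; first by lia.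
  move=> i hi; rewrite e; last by lia.
  by rewrite [RHS]Hm; congr y; lia.
Qed.

End Subshift.

(** * Closedness and recurrence of primitive subshifts *)

Lemma in_subshift_shift (A : finType) (tau : A -> seq A) (x : int -> A) (m : int) :
  in_subshift tau x -> in_subshift tau (fun i => x (i + m)).
Proof.
move=> Xx i n; have := Xx (i + m) n.
suff -> : window (fun i => x (i + m)) i n = window x (i + m) n by [].
by apply: eq_mkseq => t /=; congr x; lia.
Qed.

Lemma in_subshift_closed (A : finType) (tau : A -> seq A) :
  closed_pointset (in_subshift tau).
Proof.
move=> z H i n; have [x [Xx e]] := H (`|i| + n)%N; have := Xx i n.
suff -> : window z i n = window x i n by [].
apply: (@eq_from_nth _ (z 0)); rewrite !size_mkseq // => t tn.
by rewrite !nth_mkseq // e //; lia.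
Qed.

Lemma prefix_flatten_infix (A : eqType) (w v : seq A) (ss : seq (seq A)) (S : nat) :
  (forall s, s \in ss -> (size s <= S)%N && infix w s) ->
  (S < size v)%N -> prefix v (flatten ss) -> infix w v.
Proof.
case: ss => [|s ss] H Sv /prefixP [u e].
  by move/(congr1 size): e; rewrite size_cat /=; lia.
have /andP [sS ws] := H s (mem_head _ _).
apply: (infix_trans ws).
have e2 : s = take (size s) v.
  have := congr1 (take (size s)) e; rewrite /= take_size_cat // takel_cat //.
  by lia.
by rewrite e2 infix_take.
Qed.

(** A factor longer than twice the maximal block length contains a whole block: what remains after
    its first, possibly partial block is still longer than a block. *)
Lemma infix_flatten_infix (A : eqType) (w v : seq A) (ss : seq (seq A)) (S : nat) :
  (forall s, s \in ss -> (size s <= S)%N && infix w s) ->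
  (S + S < size v)%N -> infix v (flatten ss) -> infix w v.
Proof.
elim: ss => [|s ss IH] H Sv /infixP [u [u' e]].
  by move/(congr1 size): e; rewrite !size_cat /=; lia.
have /andP [sS ws] := H s (mem_head _ _).
have H' t : t \in ss -> (size t <= S)%N && infix w t.
  by move=> tss; apply: H; rewrite inE tss orbT.
have [us|su] := leqP (size s) (size u).
  apply: IH => //; apply/infixP; exists (drop (size s) u), u'.
  have := congr1 (drop (size s)) e; rewrite /= drop_size_cat // => ->.
  rewrite drop_cat; case: ltnP => // us2; have -> : size s = size u by lia.
  by rewrite subnn drop0 drop_size.
have := congr1 (drop (size s)) e; rewrite /= drop_size_cat // drop_cat.
rewrite ltnNge (ltnW su) /= drop_cat ifT; last by lia.
move=> e2.
have pf : prefix (drop (size s - size u) v) (flatten ss) by apply/prefixP; exists u'.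
apply: (infix_trans (prefix_flatten_infix H' _ pf)).
  by rewrite size_drop; lia.
exact: infix_drop.
Qed.

Section PrimitiveSubshift.
Variables (A : finType) (tau : A -> seq A).
Hypothesis ptau : primitive tau.

Lemma language_in_all_images (w : seq A) : in_language tau w ->
  exists m, forall b, infix w (iter_subst tau m b).
Proof.
case: ptau => [[m [m0 Hm]] _] [m' [a [_ wa]]].
exists (m' + m)%N => b; apply: (infix_trans wa).
rewrite /iter_subst iterD; apply: infix_iter_subst_word; rewrite infix1s; exact: Hm.
Qed.

(** By primitivity [tau^m' a] is a factor of [tau^(m' + n q) a] for every [n], so the exponent
    witnessing membership in the language may be taken at least [m]. *)
Lemma language_desubstitute (w : seq A) (m : nat) : in_language tau w ->
  exists s, infix w (iter m (subst_word tau) s).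
Proof.
case: ptau => [[q [q0 Hq]] _] [m' [a [_ wa]]].
have H n : infix (iter_subst tau m' a) (iter_subst tau (m' + n * q) a).
  elim: n => [|n IH]; first by rewrite mul0n addn0 infix_refl.
  apply: (infix_trans IH); rewrite mulSnr addnA /iter_subst [X in infix _ X]iterD.
  apply: infix_iter_subst_word; rewrite infix1s; exact: Hq.
exists (iter (m' + m * q - m) (subst_word tau) [:: a]).
rewrite -iterD subnKC; last by nia.
exact: (infix_trans wa (H m)).
Qed.

(** For a suitable [m] the window of [z] occurs in [tau^m b] for all letters [b], and every window
    of [x] longer than [S + S] contains such a block. The gaps are thus bounded, which gives
    occurrences on both sides of [i]. *)
Lemma subshift_recurrent (z x : int -> A) (l i : int) (n : nat) :
  in_subshift tau z -> in_subshift tau x ->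
  (exists2 j : int, i <= j & forall t : nat, (t <= n)%N -> z (l + t%:Z) = x (j + t%:Z)) /\
  (exists2 j : int, j <= i & forall t : nat, (t <= n)%N -> z (l + t%:Z) = x (j + t%:Z)).
Proof.
move=> Xz Xx.
have [m Hm] := language_in_all_images (Xz l n).
pose S := (\max_(b : A) size (iter_subst tau m b))%N.
have H (i' : int) : exists s : nat, (s + n < (S + S).+1)%N /\
    forall t : nat, (t <= n)%N -> z (l + t%:Z) = x (i' + s%:Z + t%:Z).
  have [w Hw] := language_desubstitute m (Xx i' (S + S)%N).
  rewrite iter_subst_wordE in Hw.
  have : infix (window z l n) (window x i' (S + S)).
    apply: infix_flatten_infix Hw; last by rewrite size_mkseq.
    move=> s /mapP [b _ ->]; rewrite Hm andbT.
    exact: (leq_bigmax_cond (F := fun b => size (iter_subst tau m b))).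
  case/(infix_windowP (z 0)) => s [sz e]; exists s; rewrite size_mkseq in sz; split=> // t tn.
  rewrite e // nth_mkseq; last by lia.
  by congr x; lia.
split.
  by have [s [_ e]] := H i; exists (i + s%:Z) => //; lia.
have [s [sz e]] := H (i - (S + S)%N%:Z); exists (i - (S + S)%N%:Z + s%:Z) => //.
by lia.
Qed.

Hypothesis atau : aperiodic tau.

Lemma exists_right_asymptotic : exists x y,
  [/\ in_subshift tau x, in_subshift tau y, right_eq x y & ~ orbit_eq x y].
Proof.
apply: right_asymptotic_orbits => //.
- exact: in_subshift_shift.
- exact: in_subshift_closed.
- by move=> z x l i n Xz Xx; have [] := subshift_recurrent l i n Xz Xx.
Qed.

(** The reflection [i -> -i] exchanges left and right; recurrence of the reflected set is recurrence
    to the left. *)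
Lemma exists_left_asymptotic : exists x y,
  [/\ in_subshift tau x, in_subshift tau y, left_eq x y & ~ orbit_eq x y].
Proof.
have [||||x [y [Px Py [m [M e]] ne]]] :=
    @right_asymptotic_orbits _ (fun x => in_subshift tau (fun i => x (- i))).
- move=> x m /(in_subshift_shift (- m)).
  suff -> : (fun i => x (- (i + - m))) = (fun i => x (- i + m)) by [].
  by apply: functional_extensionality => i; congr x; lia.
- move=> z H; apply: in_subshift_closed => K; have [x [Px e]] := H K.
  by exists (fun i => x (- i)); split=> // i iK; apply: e; lia.
- move=> z x l i n Pz Px.
  have [_ [j ji e]] := subshift_recurrent (- l - n%:Z) (- i - n%:Z) n Pz Px.
  exists (- j - n%:Z); first by lia.
  move=> t tn; have := e (n - t)%N; rewrite leq_subr => /(_ isT).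
  have -> : - (- l - n%:Z + (n - t)%N%:Z) = l + t%:Z by lia.
  by have -> : - (j + (n - t)%N%:Z) = - j - n%:Z + t%:Z by lia.
- case=> n [f Hf]; apply: atau; exists n, (fun k i => f k (- i)) => x Xx.
  have [|k Hk] := Hf (fun i => x (- i)).
    suff -> : (fun i => x (- - i)) = x by [].
    by apply: functional_extensionality => i; rewrite opprK.
  by exists k; rewrite -Hk; apply: functional_extensionality => i; rewrite opprK.
exists (fun i => x (- i)), (fun i => y (- i)); split=> //.
  by exists (- m), (- M) => i hi; rewrite e; [congr y|]; lia.
case=> s Hs; apply: ne; exists (- s) => i.
by rewrite -[i in LHS]opprK Hs; congr y; lia.
Qed.

End PrimitiveSubshift.

(** * Asymptotic relations and necessity of the four conditions *)

Section AsymptoticRelations.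
Variable A : finType.
Implicit Types x y z : int -> A.

Lemma orbit_eq_sym x y : orbit_eq x y -> orbit_eq y x.
Proof. by case=> m H; exists (- m) => i; rewrite H; congr y; lia. Qed.

Lemma orbit_eq_trans x y z : orbit_eq x y -> orbit_eq y z -> orbit_eq x z.
Proof. by case=> m H [m' H']; exists (m + m') => i; rewrite H H'; congr z; lia. Qed.

Lemma right_eq_sym x y : right_eq x y -> right_eq y x.
Proof.
case=> m [M H]; exists (- m), (M + m) => i hi.
by rewrite H; [congr y|]; lia.
Qed.

Lemma right_eq_trans x y z : right_eq x y -> right_eq y z -> right_eq x z.
Proof.
case=> m [M H] [m' [M' H']]; exists (m + m'), (Num.max M (M' - m)) => i hi.
by rewrite H ?H'; [congr z| |]; lia.
Qed.

Lemma left_eq_sym x y : left_eq x y -> left_eq y x.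
Proof.
case=> m [M H]; exists (- m), (M + m) => i hi.
by rewrite H; [congr y|]; lia.
Qed.

Lemma left_eq_trans x y z : left_eq x y -> left_eq y z -> left_eq x z.
Proof.
case=> m [M H] [m' [M' H']]; exists (m + m'), (Num.min M (M' - m)) => i hi.
by rewrite H ?H'; [congr z| |]; lia.
Qed.

Lemma orbit_eq_right x y : orbit_eq x y -> right_eq x y.
Proof. by case=> m H; exists m, 0 => i _. Qed.

Lemma orbit_eq_left x y : orbit_eq x y -> left_eq x y.
Proof. by case=> m H; exists m, 0 => i _. Qed.

Lemma right_asymptotic_special (tau : A -> seq A) x y :
  in_subshift tau x -> in_subshift tau y -> right_eq x y -> ~ orbit_eq x y ->
  special tau x.
Proof. by move=> Xx Xy e ne; split=> //; left; exists y. Qed.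

Lemma left_asymptotic_special (tau : A -> seq A) x y :
  in_subshift tau x -> in_subshift tau y -> left_eq x y -> ~ orbit_eq x y ->
  special tau x.
Proof. by move=> Xx Xy e ne; split=> //; right; exists y. Qed.

End AsymptoticRelations.

Lemma config_graph_undecided (A : finType) (tau : A -> seq A)
    (L R E : finType) (src : E -> L) (tgt : E -> R) :
  primitive tau -> aperiodic tau -> config_iso tau src tgt -> undecided src tgt.
Proof.
move=> ptau atau [fE [fL [fR [spE [injE [surE [spL [injL [surL [spR [injR [surR inc]]]]]]]]]]]].
have XE e : in_subshift tau (fE e) by case: (spE e).
(* Asymptotic points in distinct orbits are both special, so they are represented by two distinct
   edges; these share an endpoint because [fL] separates the classes. *)
have lft x y : in_subshift tau x -> in_subshift tau y -> left_eq x y -> ~ orbit_eq x y ->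
    exists e1 e2, [/\ e1 <> e2, src e1 = src e2, orbit_eq (fE e1) x & orbit_eq (fE e2) y].
  move=> Xx Xy exy ne.
  have [e1 h1] := surE x (left_asymptotic_special Xx Xy exy ne).
  have [|e2 h2] := surE y.
    by apply: (left_asymptotic_special Xy Xx (left_eq_sym exy)) => /orbit_eq_sym.
  exists e1, e2; split=> //.
    by move=> e; apply: ne; apply: orbit_eq_trans h2; rewrite -e; apply: orbit_eq_sym.
  apply: injL; have [i1 _] := inc e1; have [i2 _] := inc e2.
  apply: (left_eq_trans (left_eq_sym i1)); apply: left_eq_trans i2.
  apply: (left_eq_trans (orbit_eq_left h1)); apply: (left_eq_trans exy).
  exact/orbit_eq_left/orbit_eq_sym.
have rgt x y : in_subshift tau x -> in_subshift tau y -> right_eq x y -> ~ orbit_eq x y ->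
    exists e1 e2, [/\ e1 <> e2, tgt e1 = tgt e2, orbit_eq (fE e1) x & orbit_eq (fE e2) y].
  move=> Xx Xy exy ne.
  have [e1 h1] := surE x (right_asymptotic_special Xx Xy exy ne).
  have [|e2 h2] := surE y.
    by apply: (right_asymptotic_special Xy Xx (right_eq_sym exy)) => /orbit_eq_sym.
  exists e1, e2; split=> //.
    by move=> e; apply: ne; apply: orbit_eq_trans h2; rewrite -e; apply: orbit_eq_sym.
  apply: injR; have [_ i1] := inc e1; have [_ i2] := inc e2.
  apply: (right_eq_trans (right_eq_sym i1)); apply: right_eq_trans i2.
  apply: (right_eq_trans (orbit_eq_right h1)); apply: (right_eq_trans exy).
  exact/orbit_eq_right/orbit_eq_sym.
split; [split|split; [|split]].
- move=> v; have [_ [x [sx ex]]] := spL v; have [e he] := surE x sx; exists e.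
  apply: injL; have [ie _] := inc e; apply: (left_eq_trans (left_eq_sym ie)).
  by apply: (left_eq_trans (orbit_eq_left he)); apply: left_eq_sym.
- move=> v; have [_ [x [sx ex]]] := spR v; have [e he] := surE x sx; exists e.
  apply: injR; have [_ ie] := inc e; apply: (right_eq_trans (right_eq_sym ie)).
  by apply: (right_eq_trans (orbit_eq_right he)); apply: right_eq_sym.
- move=> e; have [_ [[y [Xy [exy ne]]]|[y [Xy [exy ne]]]]] := spE e.
    have [e1 [e2 [d12 t12 h1 _]]] := rgt _ _ (XE e) Xy exy ne.
    by move/injE: h1 => h1; subst e1; exists e2; split; [move=> h; apply: d12|right].
  have [e1 [e2 [d12 t12 h1 _]]] := lft _ _ (XE e) Xy exy ne.
  by move/injE: h1 => h1; subst e1; exists e2; split; [move=> h; apply: d12|left].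
- have [x [y [Xx Xy exy ne]]] := exists_left_asymptotic ptau atau.
  by have [e1 [e2 [d12 t12 _ _]]] := lft _ _ Xx Xy exy ne; exists e1, e2.
- have [x [y [Xx Xy exy ne]]] := exists_right_asymptotic ptau atau.
  by have [e1 [e2 [d12 t12 _ _]]] := rgt _ _ Xx Xy exy ne; exists e1, e2.
Qed.

(** * Letters of images under constant length substitutions *)

Lemma int_euclid (k : nat) (u : int) : (0 < k)%N ->
  exists (n : int) (r : nat), (r < k)%N /\ u = k%:Z * n + r%:Z.
Proof.
move=> k0; exists (u %/ k%:Z)%Z, (absz (u %% k%:Z)%Z).
have h1 : 0 <= (u %% k%:Z)%Z by apply: modz_ge0; lia.
have h2 : (u %% k%:Z)%Z < k%:Z by apply: ltz_pmod; lia.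
by split; [lia|rewrite gez0_abs // mulrC -divz_eq].
Qed.

Lemma nth_subst_word (A : finType) (a0 : A) (tau : A -> seq A) (k : nat) (w : seq A) (n r : nat) :
  (forall a, size (tau a) = k) -> (n < size w)%N -> (r < k)%N ->
  nth a0 (subst_word tau w) (k * n + r) = nth a0 (tau (nth a0 w n)) r.
Proof.
move=> sz + rk; elim: w n => [|a w IH] [|n] //= nw.
  by rewrite muln0 add0n /subst_word /= nth_cat sz rk.
rewrite /subst_word /= nth_cat sz ifF; last by nia.
by rewrite -IH //; congr nth; lia.
Qed.

Lemma size_subst_word (A : finType) (tau : A -> seq A) (k : nat) (w : seq A) :
  (forall a, size (tau a) = k) -> size (subst_word tau w) = (k * size w)%N.
Proof.
move=> sz; elim: w => [|a w IH]; first by rewrite muln0.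
by rewrite /subst_word /= size_cat sz -/(subst_word tau w) IH mulnS.
Qed.

(** * Constant length substitutions with a marker *)

(* [ms_long] says that the run of [c]'s covers so much of a block that no
   translate of the marker [d c^N d] by a nonmultiple of [k] is compatible with it. *)
Record marked_subst (E : finType) (e0 : E) (tau : E -> seq E) (k p q N : nat) (c d : E) : Prop := {
  ms_size : forall e, size (tau e) = k;
  ms_p_gt0 : (0 < p)%N;
  ms_p_lt : (p.+1 < k)%N;
  ms_center : forall e, nth e0 (tau e) p = e;
  ms_full : forall a b, b \in tau a;
  ms_cd : c != d;
  ms_run : forall e r, (q < r <= q + N)%N -> nth e0 (tau e) r = c;
  ms_left : forall e, nth e0 (tau e) q = d;
  ms_right : forall e, nth e0 (tau e) (q + N).+1 = d;
  ms_end : ((q + N).+1 < k)%N;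
  ms_long : (k <= N + N + 1)%N
}.

(** * Recognizability and desubstitution *)

Section Marked.
Variables (E : finType) (e0 : E) (tau : E -> seq E) (k p q N : nat) (c d : E).
Hypothesis M : marked_subst e0 tau k p q N c d.

Let k_gt0 : (0 < k)%N. Proof. by have := ms_p_lt M; lia. Qed.

(** This says that [x] is the image of [x'], placed so that position [0] is letter number [i] of the
    block of [x' 0]. *)
Definition blocks (i : nat) (x x' : int -> E) : Prop :=
  forall (n : int) (r : nat), (r < k)%N ->
  x (k%:Z * n + r%:Z - i%:Z) = nth e0 (tau (x' n)) r.

Lemma marked_size_gt0 a : tau a != [::].
Proof. by apply: contraTneq k_gt0 => e; rewrite -(ms_size M a) e. Qed.

Lemma infix_iter_language (w : seq E) (m : nat) (a : E) :
  infix w (iter_subst tau m a) -> in_language tau w.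
Proof.
case: m => [|m] H; last by exists m.+1, a.
(* The language asks for a positive exponent; exponent [0] is absorbed because [a] occurs in
   [tau a]. *)
exists 1%N, a; split=> //; apply: (infix_trans H).
by rewrite infix1s /iter_subst /= /subst_word /= cats0 (ms_full M).
Qed.

(** Recognizability is stated on a window, with arbitrary [g] and [h], so that it also applies to
    decompositions known only locally. *)
Lemma phase_unique (x : int -> E) (lo hi : int) (i j : nat) (g h : int -> E) :
  (i < k)%N -> (j < k)%N -> lo + 4 * k%:Z <= hi ->
  (forall (n : int) (r : nat), (r < k)%N -> lo <= k%:Z * n + r%:Z - i%:Z <= hi ->
    x (k%:Z * n + r%:Z - i%:Z) = nth e0 (tau (g n)) r) ->
  (forall (n : int) (r : nat), (r < k)%N -> lo <= k%:Z * n + r%:Z - j%:Z <= hi ->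
    x (k%:Z * n + r%:Z - j%:Z) = nth e0 (tau (h n)) r) ->
  i = j.
Proof.
wlog ij : i j g h / (i <= j)%N.
  move=> W ik jk lohi Hi Hj; have [le|lt] := leqP i j.
    exact: (W i j g h).
  by apply/esym; apply: (W j i h g) => //; apply: ltnW.
move=> ik jk lohi Hi Hj; apply/eqP; rewrite eqn_leq ij /= leqNgt; apply/negP => lt.
(* Block [n] is taken near the middle of the window, so that the clash stays inside [[lo, hi]]. *)
have [n [r [rk nr]]] := int_euclid (lo + 2 * k%:Z) k_gt0.
have hend := ms_end M; have hlong := ms_long M.
have nd := ms_cd M.
(* otherwise a [d] of one decomposition meets the run of [c]'s of the other *)
have clash (n' : int) (r1 r2 : nat) : (r1 < k)%N -> (q < r2 <= q + N)%N ->
    (r1 == q) || (r1 == (q + N).+1) ->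
    lo <= k%:Z * n + r2%:Z - j%:Z <= hi ->
    k%:Z * n' + r1%:Z - i%:Z = k%:Z * n + r2%:Z - j%:Z -> False.
  move=> r1k r2k r1q bd e.
  have h2 : x (k%:Z * n + r2%:Z - j%:Z) = c.
    by rewrite Hj //; [apply: (ms_run M)|lia].
  have h1 : x (k%:Z * n' + r1%:Z - i%:Z) = d.
    rewrite Hi //; last by rewrite e.
    by case/orP: r1q => /eqP ->; [apply: (ms_left M)|apply: (ms_right M)].
  by move: nd; rewrite -h1 e h2 eqxx.
(* For a small offset the left [d] of block [n] falls into the run; for a large one the right [d] of
   block [n - 1] does, by [k <= 2N + 1]. *)
have [le|gt] := leqP (j - i) N.
  by apply: (clash n q (q + (j - i))%N); lia.
by apply: (clash (n - 1) (q + N).+1 ((q + N).+1 + (j - i) - k)%N); lia.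
Qed.

Lemma local_blocks (x : int -> E) (R : nat) : in_subshift tau x ->
  exists (i : nat) (m : nat) (a : E) (b : int), (i < k)%N /\
  forall (n : int) (r : nat), (r < k)%N -> - R%:Z <= k%:Z * n + r%:Z - i%:Z <= R%:Z ->
    [/\ 0 <= n + b, n + b < (size (iter_subst tau m a))%:Z &
        x (k%:Z * n + r%:Z - i%:Z) = nth e0 (tau (nth e0 (iter_subst tau m a) (absz (n + b)))) r].
Proof.
move=> Xx; have [m [a [m0 /(infix_windowP e0) [s [sz e]]]]] := Xx (- R%:Z) (R + R)%N.
case: m m0 sz e => // m _ sz e.
have eqi : iter_subst tau m.+1 a = subst_word tau (iter_subst tau m a) by [].
rewrite eqi (size_subst_word _ (ms_size M)) in sz e.
(* Position [0] of [x] is letter [R + s] of [tau^(m+1) a]; dividing by [k] gives its block [b] and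
   the phase [i]. *)
have [b [i [ik bi]]] := int_euclid (R%:Z + s%:Z) k_gt0.
exists i, m, a, b; split=> // n r rk bd.
move: sz e; set w := iter_subst tau m a => sz e.
have h0 : 0 <= n + b by nia.
have h1 : n + b < (size w)%:Z by nia.
split=> //.
have := e (absz (k%:Z * n + r%:Z - i%:Z + R%:Z)%R).
have -> : - R%:Z + (absz (k%:Z * n + r%:Z - i%:Z + R%:Z)%R)%:Z = k%:Z * n + r%:Z - i%:Z by lia.
move=> ->; last by lia.
rewrite -(nth_subst_word e0 (ms_size M)) //; last by lia.
congr nth; nia.
Qed.

(** Each window is cut into blocks with some phase, and all these phases agree with that of a fixed
    window of radius [2k]. Since each letter is the center of its own image, [x'] consists of the
    letters of [x] at the block centers. *)
Lemma desubstitute (x : int -> E) : in_subshift tau x ->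
  exists (i : nat) (x' : int -> E), [/\ (i < k)%N, in_subshift tau x' & blocks i x x'].
Proof.
move=> Xx; have [i [m0 [a0 [b0 [ik H0]]]]] := local_blocks (k + k) Xx.
have H (R : nat) : exists m a (b : int),
    forall (n : int) (r : nat), (r < k)%N -> - R%:Z <= k%:Z * n + r%:Z - i%:Z <= R%:Z ->
    [/\ 0 <= n + b, n + b < (size (iter_subst tau m a))%:Z &
        x (k%:Z * n + r%:Z - i%:Z) = nth e0 (tau (nth e0 (iter_subst tau m a) (absz (n + b)))) r].
  have [i' [m [a [b [ik' H]]]]] := local_blocks (R + (k + k)) Xx.
  have ii : i = i'.
    apply: (@phase_unique x (- (k + k)%N%:Z) (k + k)%N%:Z i i'
      (fun n => nth e0 (iter_subst tau m0 a0) (absz (n + b0)))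
      (fun n => nth e0 (iter_subst tau m a) (absz (n + b)))) => //; first by lia.
      by move=> n r rk bd; case: (H0 n r rk bd).
    by move=> n r rk bd; case: (H n r rk _) => //; lia.
  by subst i'; exists m, a, b => n r rk bd; apply: H => //; lia.
have pk : (p < k)%N by have := ms_p_lt M; lia.
exists i, (fun n => x (k%:Z * n + p%:Z - i%:Z)); split=> //.
  move=> n l; have [m [a [b HR]]] := H (k * `|n| + k * l + k + k)%N.
  apply: (@infix_iter_language _ m a); apply/(infix_windowP e0).
  have bd (t : nat) : (t <= l)%N ->
      - (k * `|n| + k * l + k + k)%N%:Z <= k%:Z * (n + t%:Z) + p%:Z - i%:Z
        <= (k * `|n| + k * l + k + k)%N%:Z.
    by move=> tl; rewrite mulrDr; nia.
  have [h0 _ _] := HR (n + 0%N%:Z) p pk (bd 0%N isT).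
  have [_ h1 _] := HR (n + l%:Z) p pk (bd l (leqnn l)).
  exists (absz (n + b)); split; first by lia.
  move=> t tl; have [_ _ ->] := HR (n + t%:Z) p pk (bd t tl).
  by rewrite (ms_center M); congr nth; lia.
move=> n r rk; have [m [a [b HR]]] := H (k * `|n| + k + k)%N.
have [|_ _ ->] := HR n r rk; first by nia.
have [|_ _ ->] := HR n p pk; first by nia.
by rewrite (ms_center M).
Qed.

Lemma blocks_unique_phase (x x' y y' : int -> E) (i j : nat) (lo : int) :
  (i < k)%N -> (j < k)%N -> blocks i x x' -> blocks j y y' ->
  (forall u : int, lo <= u <= lo + 4 * k%:Z -> x u = y u) -> i = j.
Proof.
move=> ik jk Bx By e.
apply: (@phase_unique x lo (lo + 4 * k%:Z) i j x' y') => // n r rk bd.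
  exact: Bx.
by rewrite e //; apply: By.
Qed.

(** * Bi-infinite fixed points spanned by the letters *)

Definition centered_image (z : int -> E) (u : int) : E :=
  nth e0 (tau (z ((u + p%:Z) %/ k%:Z)%Z)) (absz ((u + p%:Z) %% k%:Z)%Z).

Lemma centered_imageP z : blocks p (centered_image z) z.
Proof.
move=> n r rk; rewrite /centered_image subrK [_ * n]mulrC.
rewrite divzMDl ?modzMDl; last by lia.
by rewrite divz_small ?modz_small ?addr0 //; lia.
Qed.

(** The limit of the centered images of a constant sequence: the value at [u] is stable after [|u|]
    steps, so the limit can be evaluated there directly. *)
Definition fixed_point (a : E) (u : int) : E :=
  iter `|u|%N centered_image (fun _ => a) u.

(** The center is neither the first nor the last letter of a block, so passing from [u] to its block
    index is a contraction towards [0] and never crosses it. This drives the inductions on [|u|]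
    below. *)
Lemma centered_decomposition (u : int) : exists (n : int) (r : nat),
  [/\ (r < k)%N, u = k%:Z * n + r%:Z - p%:Z & (u = 0 -> n = 0 /\ r = p) /\
      (u <> 0 -> (`|n| < `|u|)%N) /\ (n <> 0 -> 0 < n /\ 0 < u \/ n < 0 /\ u < 0)].
Proof.
have [n [r [rk e]]] := int_euclid (u + p%:Z) k_gt0; exists n, r.
have := ms_p_lt M; have := ms_p_gt0 M => p0 pk.
have e2 : u = k%:Z * n + r%:Z - p%:Z by lia.
split=> //.
have [n0|[n0|n0]] : n = 0 \/ 0 < n \/ n < 0 by lia.
- by subst n; lia.
- have : 2 * (n - 1) <= k%:Z * (n - 1) by apply: ler_wpM2r; lia.
  rewrite mulrBr mulr1; lia.
- have : 2 * (- n - 1) <= k%:Z * (- n - 1) by apply: ler_wpM2r; lia.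
  rewrite mulrBr mulr1 mulrN; lia.
Qed.

Lemma fixed_point_iter (a : E) (m : nat) (u : int) : (`|u| <= m)%N ->
  iter m centered_image (fun _ => a) u = fixed_point a u.
Proof.
rewrite /fixed_point.
have step z : centered_image z 0 = z 0 :> E.
  have := @centered_imageP z 0 p; rewrite mulr0 add0r subrr (ms_center M); apply.
  by have := ms_p_lt M; lia.
have zero l : iter l centered_image (fun _ => a) 0 = a.
  by elim: l => //= l IH; rewrite step.
suff H B (v : int) m1 m2 : (`|v| <= B)%N -> (`|v| <= m1)%N -> (`|v| <= m2)%N ->
    iter m1 centered_image (fun _ => a) v = iter m2 centered_image (fun _ => a) v.
  by move=> um; apply: (H `|u|%N).
elim: B v m1 m2 => [|B IH] v m1 m2 vB v1 v2.
  have -> : v = 0 by lia.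
  by rewrite !zero.
have [->|v0] : v = 0 \/ v <> 0 by lia.
  by rewrite !zero.
case: m1 v1 => [|m1] v1; first by lia.
case: m2 v2 => [|m2] v2; first by lia.
have [n [r [rk e [_ [/(_ v0) lt _]]]]] := centered_decomposition v.
rewrite e /= !centered_imageP //; congr (nth e0 (tau _) r).
by apply: IH; lia.
Qed.

Lemma fixed_point0 (a : E) : fixed_point a 0 = a. Proof. by []. Qed.

Lemma fixed_point_blocks (a : E) : blocks p (fixed_point a) (fixed_point a).
Proof.
move=> n r rk; set u := (X in fixed_point a X = _).
rewrite -(@fixed_point_iter a (maxn `|u| `|n|).+1); last by lia.
rewrite /= /u centered_imageP // fixed_point_iter //; lia.
Qed.

(** The letter at [0] survives every centered desubstitution, and the letter at [u] is governed by
    one closer to [0] in the preimage. The property [Q] makes the desubstitution repeatable. *)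
Lemma fixed_point_unique (a : E) (Q : (int -> E) -> Prop) :
  (forall x, Q x -> exists2 x', Q x' & blocks p x x' /\ x' 0 = x 0) ->
  forall x, Q x -> x 0 = a -> forall u, x u = fixed_point a u.
Proof.
move=> desub.
suff H B x (u : int) : Q x -> x 0 = a -> (`|u| <= B)%N -> x u = fixed_point a u.
  by move=> x Qx x0 u; apply: (H `|u|%N).
elim: B x u => [|B IH] x u Qx x0 uB; first by have -> : u = 0 by lia.
have [u0|u0] : u = 0 \/ u <> 0 by lia.
  by rewrite u0.
have [x' Qx' [Bx x'0]] := desub x Qx.
have [n [r [rk e [_ [/(_ u0) lt _]]]]] := centered_decomposition u.
by rewrite e Bx // fixed_point_blocks // (IH x') ?x'0 //; lia.
Qed.

Lemma fixed_point_in_subshift (a : E) : in_subshift tau (fixed_point a).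
Proof.
have H (m : nat) : exists s : nat, [/\ (m <= s)%N, (s + m < size (iter_subst tau m a))%N &
    forall u : int, 0 <= u + s%:Z -> u + s%:Z < (size (iter_subst tau m a))%:Z ->
      fixed_point a u = nth e0 (iter_subst tau m a) (absz (u + s%:Z))].
  elim: m => [|m [s [ms sm Hs]]].
    exists 0%N; split=> // u; rewrite /= => h1 h2.
    by have -> : u = 0 by lia.
  have := ms_p_lt M; have := ms_p_gt0 M => p0 pk.
  have eqi : iter_subst tau m.+1 a = subst_word tau (iter_subst tau m a) by [].
  rewrite eqi (size_subst_word _ (ms_size M)).
  move: sm Hs; set w := iter_subst tau m a => sm Hs.
  (* The distinguished [a] at position [s] of [tau^m a] has its copy at the center of its image,
     hence at [k * s + p]. *)
  exists (k * s + p)%N; split; try nia.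
  move=> u h1 h2.
  have [n [r [rk e _]]] := centered_decomposition u.
  have h3 : 0 <= n + s%:Z by nia.
  have h4 : n + s%:Z < (size w)%:Z by nia.
  rewrite [in LHS]e fixed_point_blocks // Hs // -(nth_subst_word e0 (ms_size M)) //; last by lia.
  congr nth; nia.
move=> i n; have [s [h1 h2 Hs]] := H (`|i| + n)%N.
apply: (@infix_iter_language _ (`|i| + n) a); apply/(infix_windowP e0).
exists (absz (i + s%:Z)); split; first by lia.
by move=> t tn; rewrite Hs; [congr nth| |]; lia.
Qed.

(* A shift between two fixed points is a multiple of [k] by recognizability, and
   sampling along multiples of [k] divides it by [k]: infinite descent. *)
Lemma fixed_point_orbit_inj (a b : E) :
  orbit_eq (fixed_point a) (fixed_point b) -> a = b.
Proof.
case=> m; have := leqnn `|m|%N; move: {2}`|m|%N => B.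
have := ms_p_lt M; have := ms_p_gt0 M => p0 pk.
elim: B m => [|B IH] m mB H.
  have m0 : m = 0 by lia.
  by have := H 0; rewrite m0 addr0 !fixed_point0.
have [m0|m0] : m = 0 \/ m <> 0 by lia.
  by have := H 0; rewrite m0 addr0 !fixed_point0.
have [n [r [rk e [_ [/(_ m0) lt _]]]]] := centered_decomposition m.
suff rp : r = p.
  subst r; rewrite addrK in e; apply: (IH n); first by lia.
  move=> i; have := H (k%:Z * i).
  have := fixed_point_blocks a i (ltnW pk); rewrite addrK (ms_center M) => ->.
  have := fixed_point_blocks b (i + n) (ltnW pk); rewrite addrK (ms_center M) => <-.
  by rewrite e mulrDr.
apply/esym.
have Bx : blocks p (fixed_point a) (fixed_point a) by apply: fixed_point_blocks.
suff By : exists y', blocks r (fixed_point a) y'.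
  have [y' By'] := By.
  by apply: (@blocks_unique_phase (fixed_point a) (fixed_point a) (fixed_point a) y' p r 0) => //; lia.
exists (fun i => fixed_point b (i + n)) => i s sk.
rewrite H -fixed_point_blocks //; congr (fixed_point b _).
by rewrite e mulrDr; lia.
Qed.

(** * Desubstitution of asymptotic pairs, on both sides at once *)

Definition asymptotic_at0 (eps : int) (x y : int -> E) : Prop :=
  [/\ in_subshift tau x, in_subshift tau y,
      forall i : int, 0 < eps * i -> x i = y i & x 0 <> y 0].

Section OneSide.
Variables (eps : int) (V : eqType) (f : E -> V).
Hypothesis eps1 : eps = 1 \/ eps = -1.
(** In the application [f] is [tgt] for [eps = 1] and [src] for [eps = -1]: beyond the center an
    image depends only on this end, and images with different ends differ at a place from which on,
    outwards, their letters have equal ends. *)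
Hypothesis f_same : forall (a b : E) (r : nat), (r < k)%N -> f a = f b ->
  0 < eps * (r%:Z - p%:Z) -> nth e0 (tau a) r = nth e0 (tau b) r.
Hypothesis f_diff : forall a b : E, f a <> f b -> exists r : nat,
  [/\ (r < k)%N, nth e0 (tau a) r <> nth e0 (tau b) r &
      forall r' : nat, (r' < k)%N -> 0 <= eps * (r'%:Z - r%:Z) ->
        f (nth e0 (tau a) r') = f (nth e0 (tau b) r')].

Lemma asymptotic_desubstitute (x y : int -> E) : asymptotic_at0 eps x y ->
  exists (i : nat) (x' y' : int -> E),
    [/\ (i < k)%N, asymptotic_at0 eps x' y', blocks i x x' & blocks i y y'].
Proof.
case=> Xx Xy e ne.
have [i [x' [ik Xx' Bx]]] := desubstitute Xx.
have [j [y' [jk Xy' By]]] := desubstitute Xy.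
(* The common half contains an interval of length [4k], which fixes the phase. *)
have ij : i = j.
  case: eps1 => ep.
    apply: (blocks_unique_phase (lo := 1) ik jk Bx By) => u bu.
    by apply: e; rewrite ep; lia.
  apply: (blocks_unique_phase (lo := - (4 * k%:Z) - 1) ik jk Bx By) => u bu.
  by apply: e; rewrite ep; lia.
subst j; exists i, x', y'; split=> //; split=> //.
  move=> n hn; have pk := ltnW (ms_p_lt M).
  rewrite -(ms_center M (x' n)) -(ms_center M (y' n)) -Bx // -By //; apply: e.
  case: eps1 hn => ->; rewrite !(mul1r, mulN1r) => hn; nia.
move=> e0'; apply: ne.
have := Bx 0 i ik; have := By 0 i ik.
by rewrite mulr0 add0r subrr e0' => -> ->.
Qed.

Let block0 (i r : nat) (x x' : int -> E) :
  blocks i x x' -> (r < k)%N -> x (r%:Z - i%:Z) = nth e0 (tau (x' 0)) r.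
Proof. by move=> B rk; have := B 0 r rk; rewrite mulr0 add0r. Qed.

(** If [0] lay beyond the center of its block, [f_same] would give equal letters at [0]. If the
    center lay beyond [0], it would be in the common half and [x' 0 = y' 0]. *)
Lemma asymptotic_same_phase (x y x' y' : int -> E) (i : nat) :
  (i < k)%N -> asymptotic_at0 eps x y -> asymptotic_at0 eps x' y' ->
  blocks i x x' -> blocks i y y' -> f (x' 0) = f (y' 0) -> i = p.
Proof.
move=> ik [_ _ e ne] [_ _ _ ne'] Bx By fe.
have pk := ltnW (ms_p_lt M).
have h1 : ~ 0 < eps * (i%:Z - p%:Z).
  move=> h; apply: ne.
  by have := block0 Bx ik; have := block0 By ik; rewrite subrr => -> ->; apply: f_same.
have h2 : ~ 0 < eps * (p%:Z - i%:Z).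
  move=> h; apply: ne'; have := e _ h.
  by rewrite (block0 Bx pk) (block0 By pk) !(ms_center M).
by case: eps1 h1 h2 => ->; rewrite !(mul1r, mulN1r); lia.
Qed.

(** If the preimage letters have equal ends, the phase is centered and they reappear at [0].
    Otherwise the place [r] from [f_diff] cannot lie in the common half, so [0] is at [r] or further
    out, where ends agree. *)
Lemma asymptotic_same_end (x y : int -> E) : asymptotic_at0 eps x y -> f (x 0) = f (y 0).
Proof.
move=> xy; have [i [x' [y' [ik xy' Bx By]]]] := asymptotic_desubstitute xy.
have bx := block0 Bx ik; have bY := block0 By ik; rewrite subrr in bx bY.
have [fe|/eqP fne] := eqVneq (f (x' 0)) (f (y' 0)).
  by rewrite bx bY (asymptotic_same_phase ik xy xy' Bx By fe) !(ms_center M).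
have [r [rk nr Hr]] := f_diff fne.
rewrite bx bY; apply: Hr => //.
have h : ~ 0 < eps * (r%:Z - i%:Z).
  move=> h; apply: nr; rewrite -(block0 Bx rk) -(block0 By rk).
  by case: xy => _ _ + _; apply.
by case: eps1 h => ->; rewrite !(mul1r, mulN1r); lia.
Qed.

Lemma asymptotic_centered (x y : int -> E) : asymptotic_at0 eps x y ->
  exists x' y', [/\ asymptotic_at0 eps x' y', blocks p x x' & blocks p y y'].
Proof.
move=> xy; have [i [x' [y' [ik xy' Bx By]]]] := asymptotic_desubstitute xy.
have ip := asymptotic_same_phase ik xy xy' Bx By (asymptotic_same_end xy').
by subst i; exists x', y'.
Qed.

Lemma asymptotic_at0_sym (x y : int -> E) : asymptotic_at0 eps x y -> asymptotic_at0 eps y x.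
Proof. by case=> Xx Xy e ne; split=> // [i hi|h]; [rewrite e|apply: ne]. Qed.

(** Being a member of an asymptotic pair is preserved by centered desubstitution, so it can serve as
    the property [Q] of [fixed_point_unique]. *)
Lemma asymptotic_fixed_point (x y : int -> E) : asymptotic_at0 eps x y ->
  forall u, x u = fixed_point (x 0) u.
Proof.
move=> xy; apply: (@fixed_point_unique _ (fun x => exists y, asymptotic_at0 eps x y)) => //.
  move=> z [t zt]; have [z' [t' [zt' Bz Bt]]] := asymptotic_centered zt.
  exists z'; first by exists t'.
  split=> //.
  have := block0 Bz (ltnW (ms_p_lt M)); rewrite subrr (ms_center M) => ->.
  by [].
by exists y.
Qed.

Lemma asymptotic_classification (x y : int -> E) (m B : int) :
  in_subshift tau x -> in_subshift tau y ->
  (forall i : int, B <= eps * i -> x i = y (i + m)) ->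
  orbit_eq x y \/ exists a b,
    [/\ f a = f b, orbit_eq (fixed_point a) x & orbit_eq (fixed_point b) y].
Proof.
move=> Xx Xy H.
have [o|no] := classic (orbit_eq x y); [by left|right].
have [t0 ht0] : exists t : nat, x (eps * (B - t%:Z)) != y (eps * (B - t%:Z) + m).
  apply: NNPP => h; apply: no; exists m => i.
  have [le|lt] := lerP B (eps * i); first exact: H.
  apply/eqP/negPn/negP => ne; apply: h; exists (absz (B - eps * i)%R).
  rewrite gez0_abs ?subKr; last by lia.
  by case: eps1 lt ne => -> _; rewrite !(mul1r, mulN1r, opprK).
have ex : exists t : nat, x (eps * (B - t%:Z)) != y (eps * (B - t%:Z) + m) by exists t0.
(* The least [t] marks the disagreement closest to the common half; translating it to [0] gives a
   pair as in [asymptotic_at0]. *)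
case: (ex_minnP ex) => t ht tmin.
pose i0 := eps * (B - t%:Z).
have xy : asymptotic_at0 eps (fun i => x (i + i0)) (fun i => y (i + (i0 + m))).
  split; [exact: in_subshift_shift|exact: in_subshift_shift| |].
    move=> i hi; rewrite addrA.
    have [le|lt] := lerP B (eps * (i + i0)); first exact: H.
    apply/eqP/negPn/negP => ne.
    have := tmin (absz (B - eps * (i + i0))%R).
    have -> : eps * (B - (absz (B - eps * (i + i0))%R)%:Z) = i + i0.
      rewrite gez0_abs ?subKr; last by lia.
      by case: eps1 => ->; rewrite !(mul1r, mulN1r, opprK).
    move=> /(_ ne); rewrite /i0 in lt *.
    by case: eps1 hi lt => ->; rewrite !(mul1r, mulN1r); lia.
  by rewrite !add0r; apply/eqP.
exists (x i0), (y (i0 + m)); split.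
- by have := asymptotic_same_end xy; rewrite !add0r.
- by exists i0 => i; have /= := asymptotic_fixed_point xy i; rewrite add0r.
- exists (i0 + m) => i.
  by have /= := asymptotic_fixed_point (asymptotic_at0_sym xy) i; rewrite add0r.
Qed.

(** In block [0] the letters past the center depend only on [f]; any other block on this side has an
    index closer to [0] with the same sign, where induction applies. *)
Lemma fixed_point_asymptotic (a b : E) (u : int) :
  f a = f b -> 0 < eps * u -> fixed_point a u = fixed_point b u.
Proof.
move=> fab; have := leqnn `|u|%N; move: {2}`|u|%N => B.
elim: B u => [|B IH] u uB hu.
  have u0 : u = 0 by lia.
  by rewrite u0 mulr0 in hu.
have u0 : u <> 0 by move=> u0; rewrite u0 mulr0 in hu.
have [n [r [rk e [_ [/(_ u0) lt sgn]]]]] := centered_decomposition u.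
rewrite e !fixed_point_blocks //.
have [n0|n0] : n = 0 \/ n <> 0 by lia.
  rewrite n0 !fixed_point0; apply: f_same => //.
  by move: hu; rewrite e n0 mulr0 add0r.
rewrite (IH n) //; first by lia.
by have := sgn n0; case: eps1 hu => ->; rewrite !(mul1r, mulN1r); lia.
Qed.

End OneSide.

End Marked.

(** * Realizing an undecided graph *)

Lemma marked_primitive (E : finType) (e0 : E) (tau : E -> seq E) (k p q N : nat) (c d : E) :
  marked_subst e0 tau k p q N c d -> primitive tau.
Proof.
move=> M; split.
  exists 1%N; split=> // a b.
  by rewrite /iter_subst /= /subst_word /= cats0 (ms_full M).
exists e0 => K; exists K; elim: K => [|K IH] //.
have -> : iter_subst tau K.+1 e0 = subst_word tau (iter_subst tau K e0) by [].
by rewrite (size_subst_word _ (ms_size M)); have := ms_p_lt M; nia.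
Qed.

(** Pigeonhole: among [n + 1] shifts two coincide. *)
Lemma finite_pointset_periodic (A : finType) (P : (int -> A) -> Prop) (x : int -> A) :
  finite_pointset P -> (forall m : int, P (fun i => x (i + m))) ->
  exists2 m : nat, (0 < m)%N & forall i : int, x i = x (i + m%:Z).
Proof.
move=> [n [f Hf]] Px.
have H (s : 'I_n.+1) : exists k, (fun i => x (i + s%:Z)) = f k by apply: Hf.
pose g s := proj1_sig (constructive_indefinite_description _ (H s)).
have gP (s : 'I_n.+1) : (fun i => x (i + s%:Z)) = f (g s).
  exact: (proj2_sig (constructive_indefinite_description _ (H s))).
have ninj : ~ injective g by move/leq_card; rewrite !card_ord ltnn.
apply: NNPP => no; apply: ninj.
have lt_ne (s t : 'I_n.+1) : (s < t)%N -> g s <> g t.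
  move=> st e; apply: no; exists (t - s)%N; first by lia.
  move=> i; have := congr1 (fun h => h (i - s%:Z)) (etrans (gP s) (etrans (congr1 f e) (esym (gP t)))).
  by rewrite /= subrK => ->; congr x; lia.
move=> s t e; apply: val_inj; have [/lt_ne|/lt_ne|//] := ltngtP s t => //.
by move=> /(_ (esym e)).
Qed.

(** A code for vertices over two letters. When [c] and [d] share an endpoint, distinct codes still
    have letterwise equal endpoints. *)
Definition indicator_word (V E : finType) (c d : E) (v : V) : seq E :=
  [seq (if v' == v then c else d) | v' <- enum V].

Lemma nth_indicator_word (V E : finType) (e0 c d : E) (v : V) (r : nat) : (r < #|V|)%N ->
  nth e0 (indicator_word c d v) r = c \/ nth e0 (indicator_word c d v) r = d.
Proof.
move=> rV; rewrite (nth_map v) -?cardE //.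
by case: ifP; [left|right].
Qed.

Lemma indicator_word_diff (V E : finType) (e0 c d : E) (v v' : V) : c <> d -> v <> v' ->
  exists2 r, (r < #|V|)%N &
    nth e0 (indicator_word c d v) r <> nth e0 (indicator_word c d v') r.
Proof.
move=> cd vv'; have rV : (index v (enum V) < #|V|)%N by rewrite cardE index_mem mem_enum.
exists (index v (enum V)) => //.
have rs : (index v (enum V) < size (enum V))%N by rewrite -cardE.
rewrite /indicator_word (nth_map v) // nth_index ?mem_enum // eqxx.
by rewrite (nth_map v) // nth_index ?mem_enum // ifF //; apply/eqP.
Qed.

Section Realization.
Variables (L R E : finType) (src : E -> L) (tgt : E -> R).
Variables (c d c' d' : E).
Hypothesis cd : c <> d.
Hypothesis tgt_cd : tgt c = tgt d.
Hypothesis cd' : c' <> d'.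
Hypothesis src_cd' : src c' = src d'.

Let p := (#|L| + #|E|)%N.
(** Since [N = p + #|R| + 2], the length is [k = 2N + 1], the largest that [ms_long] admits. *)
Let N := (#|L| + #|E| + #|R| + 2)%N.
Let k := (p + N + #|R| + 3)%N.

(* The image of [e] is [indicator_word c' d' (src e)], all letters, [e], the marker
   [d c^N d] and [indicator_word c d (tgt e)]. Hence the first (last) letters where two
   images differ have the same source (target), whatever the sources (targets) of the
   two preimages. *)
Definition graph_letter (e : E) (r : nat) : E :=
  if (r < #|L|)%N then nth c (indicator_word c' d' (src e)) r
  else if (r < p)%N then nth c (enum E) (r - #|L|)
  else if r == p then e
  else if r == p.+1 then d
  else if (r <= p.+1 + N)%N then c
  else if r == (p.+1 + N).+1 then d
  else nth c (indicator_word c d (tgt e)) (r - (p + N + 3)).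

Definition graph_subst (e : E) : seq E := mkseq (graph_letter e) k.

Let nthE (e : E) (r : nat) : (r < k)%N -> nth c (graph_subst e) r = graph_letter e r.
Proof. by move=> rk; rewrite nth_mkseq. Qed.

Let E_gt0 : (0 < #|E|)%N. Proof. by apply/card_gt0P; exists c. Qed.

Lemma graph_subst_marked : marked_subst c graph_subst k p p.+1 N c d.
Proof.
split; rewrite ?/k ?/p ?/N; try lia.
- by move=> e; rewrite size_mkseq.
- move=> e; rewrite nthE /graph_letter /k /p; last by lia.
  by rewrite 2?ifF ?eqxx //; lia.
- move=> a b.
  have bE : (index b (enum E) < #|E|)%N by rewrite cardE index_mem mem_enum.
  have rk : (#|L| + index b (enum E) < k)%N by rewrite /k /p; lia.
  have <- : nth c (graph_subst a) (#|L| + index b (enum E)) = b.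
    rewrite nthE // /graph_letter ifF 1?ifT ?addKn ?nth_index ?mem_enum // /p; lia.
  by apply: mem_nth; rewrite size_mkseq.
- exact/eqP.
- move=> e r hr; rewrite nthE /graph_letter /k /p; last by lia.
  by rewrite 4?ifF 1?ifT // /N; lia.
- move=> e; rewrite nthE /graph_letter /k /p; last by lia.
  by rewrite 3?ifF ?eqxx //; lia.
- move=> e; rewrite nthE /graph_letter /k /p /N; last by lia.
  by rewrite 5?ifF ?eqxx //; lia.
Qed.

Lemma graph_subst_same_src (a b : E) (r : nat) : (r < k)%N -> src a = src b ->
  0 < -1 * (r%:Z - p%:Z) -> nth c (graph_subst a) r = nth c (graph_subst b) r.
Proof.
move=> rk ab rp; rewrite !nthE // /graph_letter ab.
have -> : (r < p)%N by lia.
by [].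
Qed.

Lemma graph_subst_same_tgt (a b : E) (r : nat) : (r < k)%N -> tgt a = tgt b ->
  0 < 1 * (r%:Z - p%:Z) -> nth c (graph_subst a) r = nth c (graph_subst b) r.
Proof.
move=> rk ab rp; rewrite !nthE // /graph_letter ab.
have -> : (r < #|L|)%N = false by rewrite /p in rp; lia.
have -> : (r < p)%N = false by lia.
by have -> : (r == p) = false by lia.
Qed.

Lemma graph_subst_diff_src (a b : E) : src a <> src b -> exists r : nat,
  [/\ (r < k)%N, nth c (graph_subst a) r <> nth c (graph_subst b) r &
      forall r' : nat, (r' < k)%N -> 0 <= -1 * (r'%:Z - r%:Z) ->
        src (nth c (graph_subst a) r') = src (nth c (graph_subst b) r')].
Proof.
move=> ab; have [r rL ne] := indicator_word_diff c cd' ab.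
have rk : (r < k)%N by rewrite /k /p; lia.
exists r; split=> //; first by rewrite !nthE // /graph_letter rL.
move=> r' rk' h; rewrite !nthE // /graph_letter.
have rL' : (r' < #|L|)%N by lia.
rewrite rL'.
by have [->|->] := nth_indicator_word c c' d' (src a) rL';
   have [->|->] := nth_indicator_word c c' d' (src b) rL'.
Qed.

Lemma graph_subst_diff_tgt (a b : E) : tgt a <> tgt b -> exists r : nat,
  [/\ (r < k)%N, nth c (graph_subst a) r <> nth c (graph_subst b) r &
      forall r' : nat, (r' < k)%N -> 0 <= 1 * (r'%:Z - r%:Z) ->
        tgt (nth c (graph_subst a) r') = tgt (nth c (graph_subst b) r')].
Proof.
move=> ab; have [r rR ne] := indicator_word_diff c cd ab.
have tail e s : (p + N + 3 <= s)%N ->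
    graph_letter e s = nth c (indicator_word c d (tgt e)) (s - (p + N + 3)).
  by move=> h; rewrite /graph_letter !ifF //; rewrite /p in h *; lia.
have rk : (p + N + 3 + r < k)%N by rewrite /k; lia.
exists (p + N + 3 + r)%N; split=> //.
  by rewrite !nthE // !tail ?leq_addr // addKn.
move=> r' rk' h; rewrite !nthE // !tail; try lia.
have rR' : (r' - (p + N + 3) < #|R|)%N by move: rk'; rewrite /k; lia.
by have [->|->] := nth_indicator_word c c d (tgt a) rR';
   have [->|->] := nth_indicator_word c c d (tgt b) rR'.
Qed.

(** * Special orbits of the constructed substitution *)

Let M := graph_subst_marked.
Let X := in_subshift graph_subst.
Definition edge_point : E -> int -> E := fixed_point c graph_subst k p.

Let edge_in e : X (edge_point e).
Proof. exact: (fixed_point_in_subshift M). Qed.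

Let edge_inj a b : orbit_eq (edge_point a) (edge_point b) -> a = b.
Proof. exact: (fixed_point_orbit_inj M). Qed.

Lemma edge_right_eq a b : tgt a = tgt b -> right_eq (edge_point a) (edge_point b).
Proof.
move=> ab; exists 0, 1 => i hi; rewrite addr0.
apply: (fixed_point_asymptotic M _ graph_subst_same_tgt ab); first by left.
by lia.
Qed.

Lemma edge_left_eq a b : src a = src b -> left_eq (edge_point a) (edge_point b).
Proof.
move=> ab; exists 0, (-1) => i hi; rewrite addr0.
apply: (fixed_point_asymptotic M _ graph_subst_same_src ab); first by right.
by lia.
Qed.

Lemma right_eq_classification x y : X x -> X y -> right_eq x y ->
  orbit_eq x y \/ exists a b,
    [/\ tgt a = tgt b, orbit_eq (edge_point a) x & orbit_eq (edge_point b) y].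
Proof.
move=> Xx Xy [m [B H]].
apply: (asymptotic_classification M _ graph_subst_same_tgt graph_subst_diff_tgt (m := m) (B := B)) => //.
  by left.
by move=> i hi; apply: H; lia.
Qed.

Lemma left_eq_classification x y : X x -> X y -> left_eq x y ->
  orbit_eq x y \/ exists a b,
    [/\ src a = src b, orbit_eq (edge_point a) x & orbit_eq (edge_point b) y].
Proof.
move=> Xx Xy [m [B H]].
apply: (asymptotic_classification M _ graph_subst_same_src graph_subst_diff_src (m := m) (B := - B)) => //.
  by right.
by move=> i hi; apply: H; lia.
Qed.

Lemma edge_right_eq_tgt a b : right_eq (edge_point a) (edge_point b) -> tgt a = tgt b.
Proof.
case/(right_eq_classification (edge_in a) (edge_in b)) => [/edge_inj -> //|].
by case=> a' [b' [e /edge_inj <- /edge_inj <-]].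
Qed.

Lemma edge_left_eq_src a b : left_eq (edge_point a) (edge_point b) -> src a = src b.
Proof.
case/(left_eq_classification (edge_in a) (edge_in b)) => [/edge_inj -> //|].
by case=> a' [b' [e /edge_inj <- /edge_inj <-]].
Qed.

Lemma special_is_edge x : special graph_subst x -> exists e, orbit_eq (edge_point e) x.
Proof.
case=> Xx [[y [Xy [e ne]]]|[y [Xy [e ne]]]].
  have [//|[a [b [_ ha _]]]] := right_eq_classification Xx Xy e.
  by exists a.
have [//|[a [b [_ ha _]]]] := left_eq_classification Xx Xy e.
by exists a.
Qed.

(** In a finite subshift the points of [c] and [d] would both be periodic; having a common right
    half, they would coincide at [0] as well. *)
Lemma graph_subst_aperiodic : aperiodic graph_subst.
Proof.
move=> fin.
have per e : exists2 m : nat, (0 < m)%N & forall i : int, edge_point e i = edge_point e (i + m%:Z).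
  by apply: (finite_pointset_periodic fin) => m; apply: in_subshift_shift; apply: edge_in.
have [m m0 Hm] := per c; have [n n0 Hn] := per d.
have iterp e (s : nat) (t : nat) (i : int) : (forall i : int, edge_point e i = edge_point e (i + s%:Z)) ->
    edge_point e (i + (t * s)%N%:Z) = edge_point e i.
  move=> h; elim: t => [|t IH]; first by rewrite mul0n addr0.
  by rewrite -IH [RHS]h; congr edge_point; lia.
apply: cd.
have -> : c = edge_point c 0 by [].
have -> : d = edge_point d 0 by [].
(* The common multiple [n * m] of both periods carries position [0] into the common right half. *)
rewrite -(iterp c m n 0 Hm) -(iterp d n m 0 Hn) mulnC !add0r.
apply: (fixed_point_asymptotic M _ graph_subst_same_tgt tgt_cd); first by left.
by nia.
Qed.

Hypothesis src_surj : forall v : L, exists e, src e = v.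
Hypothesis tgt_surj : forall w : R, exists e, tgt e = w.
Hypothesis no_isolated : forall e, exists e', e' <> e /\ (src e' = src e \/ tgt e' = tgt e).

Lemma edge_special e : special graph_subst (edge_point e).
Proof.
have [e' [ne [s|t]]] := no_isolated e.
  apply: (left_asymptotic_special (edge_in e) (edge_in e')); first exact: edge_left_eq.
  by move/edge_inj=> h; apply: ne.
apply: (right_asymptotic_special (edge_in e) (edge_in e')); first exact: edge_right_eq.
by move/edge_inj=> h; apply: ne.
Qed.

Lemma graph_subst_config : config_iso graph_subst src tgt.
Proof.
(* A vertex is represented by the point of any edge chosen at it. *)
pose eL v := proj1_sig (constructive_indefinite_description _ (src_surj v)).
have eLP v : src (eL v) = v by apply: (proj2_sig (constructive_indefinite_description _ (src_surj v))).
pose eR v := proj1_sig (constructive_indefinite_description _ (tgt_surj v)).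
have eRP v : tgt (eR v) = v by apply: (proj2_sig (constructive_indefinite_description _ (tgt_surj v))).
exists edge_point, (fun v => edge_point (eL v)), (fun w => edge_point (eR w)).
split; first exact: edge_special.
split; first exact: edge_inj.
split; first exact: special_is_edge.
split.
  move=> v; split; first exact: edge_in.
  by exists (edge_point (eL v)); split; [exact: edge_special|exact: edge_left_eq].
split; first by move=> v v' /edge_left_eq_src; rewrite !eLP.
split.
  move=> x /special_is_edge [e he]; exists (src e).
  by apply: left_eq_trans (orbit_eq_left he); apply: edge_left_eq; rewrite eLP.
split.
  move=> w; split; first exact: edge_in.
  by exists (edge_point (eR w)); split; [exact: edge_special|exact: edge_right_eq].
split; first by move=> w w' /edge_right_eq_tgt; rewrite !eRP.
split.
  move=> x /special_is_edge [e he]; exists (tgt e).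
  by apply: right_eq_trans (orbit_eq_right he); apply: edge_right_eq; rewrite eRP.
by move=> e; split; [apply: edge_left_eq|apply: edge_right_eq]; rewrite ?eLP ?eRP.
Qed.

End Realization.

Theorem mainTheorem13 (L R E : finType) (src : E -> L) (tgt : E -> R) :
  (exists (A : finType) (tau : A -> seq A),
      (0 < #|A|)%N /\ nonerasing tau /\ primitive tau /\ aperiodic tau /\
      config_iso tau src tgt)
  <-> undecided src tgt.
Proof.
split.
  by case=> A [tau [_ [_ [ptau [atau iso]]]]]; apply: config_graph_undecided iso.
(* Condition (iii) supplies the letters [c'], [d'] of the source code, condition (iv) the letters
   [c], [d] of the target code and the marker. *)
case=> [[src_surj tgt_surj] [no_iso [[c' [d' [cd' sE]]] [c [d [cd tE]]]]]].
have M := graph_subst_marked src tgt c' d' cd.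
exists E, (graph_subst src tgt c d c' d').
split; first by apply/card_gt0P; exists c.
split; first exact: (marked_size_gt0 M).
split; first exact: (marked_primitive M).
split; first exact: graph_subst_aperiodic.
exact: graph_subst_config.
Qed.
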